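(* Let $q$ be a prime power with $4\mid(q+1)$ and $3\mid(q-1)$, and let $G=\operatorname{PGL}_2(q)$. Then $G$ has an absolutely irreducible unisingular representation into $\operatorname{Sp}_{q+1}(2)$.
   Context: A representation $\varphi:G\to\operatorname{GL}(V)$ of a finite group over a field is unisingular if $\det(\varphi(g)-1)=0$ for all $g\in G$. $\operatorname{Sp}_{q+1}(2)$ is the symplectic group of a non-degenerate alternating form on $\mathbb{F}_2^{q+1}$. *)

(* Defs.v *)
From HB Require Import structures.
From mathcomp Require Import all_boot all_order all_algebra.
From mathcomp Require Import all_fingroup all_solvable all_field all_character.

Set Implicit Arguments.
Unset Strict Implicit.
Unset Printing Implicit Defensive.

Import GRing.Theory.
Import GroupScope.
Local Open Scope ring_scope.

Definition PGL (n : nat) (F : finFieldType) :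
    {group coset_of 'Z('GL_n[F])} :=
  ('GL_n[F] / 'Z('GL_n[F]))%G.

(* A matrix J stands for the bilinear form (u, v) |-> u J v^T on row vectors,
   on which matrices act by right multiplication, as in mx_representation. *)
Section Forms.

Variables (K : fieldType) (n : nat).
Implicit Type J A : 'M[K]_n.

(* b(u, u) = 0 for all u; over 'F_2 this is stronger than J^T = - J. *)
Definition alternating_form J : Prop :=
  forall u : 'rV[K]_n, u *m J *m u^T = 0.

Definition nondegenerate_form J : Prop :=
  forall u : 'rV[K]_n, (forall v : 'rV[K]_n, u *m J *m v^T = 0) -> u = 0.

(* The symplectic group of J. A need not be assumed invertible: this follows
   when J is nondegenerate. *)
Definition Sp J : pred 'M[K]_n := fun A => A *m J *m A^T == J.

End Forms.

Definition unisingular (K : fieldType) (gT : finGroupType) (G : {group gT})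
    (n : nat) (rG : mx_representation K G n) : Prop :=
  forall g : gT, g \in G -> \det (rG g - 1%:M) = 0.

(* Main.v *)
(* Let chi be a cubic character of F^* with values in F_4^*. Matrices g act on the
   functions f on F^2 - {0} with f(a v) = chi(a) f(v) by
   (g f)(v) = chi(det g) f(v g); scalars act trivially, and the values of f at
   representatives of the q + 1 points of P^1(F) are coordinates in which g is
   monomial.
   - Absolute irreducibility: the sum of the unipotent matrices fixing infinity,
     combined with a diagonal matrix on which chi is nontrivial, yields the matrix
     unit at (infinity, infinity), and its translates are all the matrix units.
   - Symplectic form and descent to F_2: the symmetric matrix
     K = (chi(det(x, y)))_(x, y) has zero diagonal, is invariant, and intertwines
     the representation with its Galois conjugate. By Schur's lemma K K^sigma is
     scalar, equal to q = 1, so Hilbert 90 gives a basis in which everything is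
     defined over F_2.
   - Unisingularity: if m > 0 is minimal with g^m scalar, a line spanned by a
     cyclic vector of g has trivial stabiliser in <g> modulo scalars, so
     1 + g + ... + g^(m-1) acts as a nonzero operator, whose image is fixed by g. *)
Require Import Defs.
From HB Require Import structures.
From mathcomp Require Import all_boot all_order all_algebra.
From mathcomp Require Import all_fingroup all_solvable all_field all_character.
From mathcomp Require Import ring.

Set Implicit Arguments.
Unset Strict Implicit.
Unset Printing Implicit Defensive.

Import GRing.Theory.

(** * The projective line over a finite field and the determinant pairing *)

Section ProjectiveLine.

Local Open Scope ring_scope.

Variable F : finFieldType.
Implicit Types (u v : 'rV[F]_2) (g h : 'M[F]_2) (a : F).

Definition vec2 a b : 'rV[F]_2 := \row_j (if j == 0 then a else b).

Lemma vec2E0 a b : vec2 a b 0 0 = a. Proof. by rewrite mxE. Qed.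
Lemma vec2E1 a b : vec2 a b 0 1 = b. Proof. by rewrite mxE. Qed.

Lemma rV2P u v : u 0 0 = v 0 0 -> u 0 1 = v 0 1 -> u = v.
Proof.
move=> e0 e1; apply/rowP=> j; case: j => [[|[|//]] lt_j].
  by rewrite (_ : Ordinal lt_j = 0) //; apply: val_inj.
by rewrite (_ : Ordinal lt_j = 1) //; apply: val_inj.
Qed.

Lemma mulrV2E u g j : (u *m g) 0 j = u 0 0 * g 0 j + u 0 1 * g 1 j.
Proof.
rewrite mxE !big_ord_recl big_ord0 addr0 (_ : lift _ _ = 1) //.
exact: val_inj.
Qed.

Lemma det2E g : \det g = g 0 0 * g 1 1 - g 0 1 * g 1 0.
Proof.
rewrite (expand_det_row _ 0) !big_ord_recl big_ord0 addr0 /cofactor !det_mx11.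
rewrite !mxE /= expr0 expr1 !mul1r mulN1r mulrN.
congr (_ * _ - _ * _); congr (g _ _); exact: val_inj.
Qed.

Definition wedge u v := u 0 0 * v 0 1 - u 0 1 * v 0 0.

Lemma wedgeMr u v g : wedge (u *m g) (v *m g) = \det g * wedge u v.
Proof. by rewrite /wedge !mulrV2E det2E; ring. Qed.

Lemma wedgeZl a u v : wedge (a *: u) v = a * wedge u v.
Proof. by rewrite /wedge !mxE; ring. Qed.

Lemma wedgeC u v : wedge v u = - wedge u v.
Proof. by rewrite /wedge; ring. Qed.

Lemma wedgeZr a u v : wedge u (a *: v) = a * wedge u v.
Proof. by rewrite /wedge !mxE; ring. Qed.

Lemma wedgevv u : wedge u u = 0. Proof. by rewrite /wedge; ring. Qed.

Lemma mul_rV2_neq0 u g : \det g != 0 -> u != 0 -> u *m g != 0.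
Proof.
rewrite -unitfE -/(_ \in unitmx) => Ug; apply: contraNneq => ug0.
by rewrite -(mulmxK Ug u) ug0 mul0mx.
Qed.

(* P^1(F), with [Some a] the line through (a, 1) and [None] the line through
   (1, 0), numbered so as to index matrices. *)
Definition pline := 'I_#|{: option F}|.

Definition rep (x : pline) : 'rV[F]_2 :=
  if enum_val x is Some a then vec2 a 1 else vec2 1 0.

Definition pt v : pline :=
  enum_rank (if v 0 1 == 0 then None else Some (v 0 0 / v 0 1)).

(** The coordinate that [rep] normalises to 1, so that a nonzero [v] is [sc v] times the
    representative of its line. *)
Definition sc v : F := if v 0 1 == 0 then v 0 0 else v 0 1.

Lemma rep_neq0 x : rep x != 0.
Proof.
apply/eqP=> /rowP e; have := e 0; have := e 1; rewrite /rep.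
case: enum_val => [a|]; rewrite !mxE /= => /eqP; last first.
  by move=> _ /eqP; rewrite oner_eq0.
by rewrite oner_eq0.
Qed.

Lemma sc_neq0 v : v != 0 -> sc v != 0.
Proof.
rewrite /sc; case: (v 0 1 =P 0) => [v1 | /eqP //]; apply: contra => /eqP v0.
by apply/eqP/rV2P; rewrite mxE.
Qed.

Lemma rep_pt v : v != 0 -> v = sc v *: rep (pt v).
Proof.
move=> v_neq0; rewrite /rep /pt enum_rankK /sc.
case: (v 0 1 =P 0) => [v1 | /eqP v1].
  by apply: rV2P; rewrite !mxE /= ?mulr1 ?mulr0.
by apply: rV2P; rewrite !mxE /= ?mulr1 // mulrC divfK.
Qed.

Lemma pt_rep x : pt (rep x) = x.
Proof.
rewrite /pt /rep; case Ex: (enum_val x) => [a|]; rewrite ?vec2E0 ?vec2E1.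
  by rewrite oner_eq0 divr1 -Ex enum_valK.
by rewrite eqxx -Ex enum_valK.
Qed.

Lemma sc_rep x : sc (rep x) = 1.
Proof.
by rewrite /sc /rep; case: enum_val => [a|]; rewrite ?vec2E0 ?vec2E1 ?oner_eq0 ?eqxx.
Qed.

Lemma ptZ a v : a != 0 -> pt (a *: v) = pt v.
Proof.
move=> a0; rewrite /pt !mxE mulf_eq0 (negPf a0) /=.
by case: (v 0 1 =P 0) => // _; rewrite -mulf_div divff // mul1r.
Qed.

Lemma scZ a v : a != 0 -> sc (a *: v) = a * sc v.
Proof.
by move=> a0; rewrite /sc !mxE mulf_eq0 (negPf a0) /=; case: (v 0 1 =P 0).
Qed.

Lemma wedge_eq0 u v : u != 0 -> v != 0 -> (wedge u v == 0) = (pt u == pt v).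
Proof.
move=> u0 v0; apply/idP/eqP => [/eqP w0 | e]; last first.
  by rewrite (rep_pt u0) (rep_pt v0) e wedgeZl wedgeZr wedgevv !mulr0.
suff [a a0 ->] : exists2 a, a != 0 & u = a *: v by rewrite ptZ.
(* This proportionality is free of division. Each of the four cases for the vanishing of the last
   coordinates gives two goals; the mixed cases contradict the vanishing of [wedge u v]. *)
suff /eqP e : sc u *: v == sc v *: u.
  exists (sc u / sc v); first by rewrite mulf_neq0 ?invr_neq0 ?sc_neq0.
  by rewrite mulrC -scalerA e scalerA mulVf ?sc_neq0 ?scale1r.
have := sc_neq0 u0; have := sc_neq0 v0; move: w0; rewrite /wedge /sc.
move=> /eqP; rewrite subr_eq0 => /eqP w0.
case: (u 0 1 =P 0) w0 => [u1 | _];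
  case: (v 0 1 =P 0) => [v1 | _] w0 nv nu; apply/eqP/rV2P; rewrite !mxE.
- exact: mulrC.
- by rewrite u1 v1 !mulr0.
- by move/eqP: w0; rewrite u1 mul0r mulf_eq0 (negPf nu) (negPf nv).
- by move/eqP: w0; rewrite u1 mul0r mulf_eq0 (negPf nu) (negPf nv).
- by move/eqP: w0; rewrite v1 mulr0 eq_sym mulf_eq0 (negPf nu) (negPf nv).
- by move/eqP: w0; rewrite v1 mulr0 eq_sym mulf_eq0 (negPf nu) (negPf nv).
- by rewrite -w0 mulrC.
- exact: mulrC.
Qed.

Lemma pt_mulmx_inj g x y :
  \det g != 0 -> pt (rep x *m g) = pt (rep y *m g) -> x = y.
Proof.
move=> g0 /eqP; rewrite -wedge_eq0 ?mul_rV2_neq0 ?rep_neq0 // wedgeMr.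
by rewrite mulf_eq0 (negPf g0) wedge_eq0 ?rep_neq0 // !pt_rep => /eqP.
Qed.

End ProjectiveLine.

(** * The monomial representation induced by a cubic character *)

Section PrincipalSeries.

Local Open Scope ring_scope.

Lemma natr_odd_pchar2 (R : nzRingType) m :
  2%N \in [pchar R] -> odd m -> m%:R = 1 :> R.
Proof.
move=> char2 odd_m; rewrite -[m]odd_double_half odd_m -mul2n natrD natrM.
by rewrite (pcharf0 char2) mul0r addr0.
Qed.

Variables (F : finFieldType) (L : fieldType) (chi : F -> L).
Variable sigma : {rmorphism L -> L}.
Hypothesis chi0 : chi 0 = 0.
Hypothesis chi1 : chi 1 = 1.
Hypothesis chiM : {morph chi : x y / x * y}.
Hypothesis chiX3 : forall x, x != 0 -> chi x ^+ 3 = 1.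
Hypothesis sigma_chi : forall x, x != 0 -> chi x * sigma (chi x) = 1.

Implicit Types (g h : 'M[F]_2) (x y : pline F).

Local Notation n := #|{: option F}|.

Definition weight g x := chi (\det g) * chi (sc (rep x *m g)).

(* The action (g f)(v) = chi (det g) f(v g) on the functions f on F^2 - {0} with
   f(a v) = chi(a) f(v), such an f being determined by the f (rep x). *)
Definition principal_mx g : 'M[L]_n :=
  \matrix_(x, y) (weight g x *+ (y == pt (rep x *m g))).

Lemma mul_principal_mxE m g (C : 'M[L]_(n, m)) x j :
  (principal_mx g *m C) x j = weight g x * C (pt (rep x *m g)) j.
Proof.
rewrite mxE (bigD1 (pt (rep x *m g))) //= big1 ?addr0 => [|y /negPf ne_y].
  by rewrite mxE eqxx.
by rewrite mxE ne_y mul0r.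
Qed.

Lemma principal_mxM g h :
  \det g != 0 -> principal_mx (g *m h) = principal_mx g *m principal_mx h.
Proof.
move=> g0; apply/matrixP=> x y; rewrite mul_principal_mxE !mxE.
have v0 := mul_rV2_neq0 g0 (rep_neq0 x); set v := rep x *m g in v0 *.
(* Passing from [v] to the representative of its line keeps [pt] and divides [sc] by [sc v], which
   is the cocycle identity for the weights. *)
have E : rep x *m (g *m h) = sc v *: (rep (pt v) *m h).
  by rewrite mulmxA -/v {1}(rep_pt v0) scalemxAl.
rewrite /weight E -/v ptZ ?scZ ?sc_neq0 // det_mulmx !chiM.
by rewrite -mulrnAr -[_ *+ _]mulr_natr -[in RHS]mulr_natr; ring.
Qed.

(** The determinant contributes the square of [chi a] and the rescaling of [rep x] one more factor:
    the twist by [chi (\det g)] completes a cube. *)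
Lemma principal_mx_scalar a : a != 0 -> principal_mx a%:M = 1%:M.
Proof.
move=> a0; apply/matrixP=> x y; rewrite !mxE mul_mx_scalar ptZ // pt_rep.
rewrite eq_sym /weight mul_mx_scalar scZ // sc_rep mulr1 det_scalar.
by rewrite expr2 chiM -expr2 -exprSr chiX3.
Qed.

Lemma weight_neq0 g x : \det g != 0 -> weight g x != 0.
Proof.
have chi_neq0 a : a != 0 -> chi a != 0.
  move=> a0; apply/eqP=> e; move/eqP: (sigma_chi a0).
  by rewrite e mul0r eq_sym oner_eq0.
by move=> g0; rewrite mulf_neq0 ?chi_neq0 ?sc_neq0 ?mul_rV2_neq0 ?rep_neq0.
Qed.

(** Here [sigma] acts like complex conjugation: it inverts the values of [chi], hence the nonzero
    entries of a monomial matrix. *)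
Lemma principal_mx_unitary g :
  \det g != 0 -> principal_mx g *m (map_mx sigma (principal_mx g))^T = 1%:M.
Proof.
move=> g0; apply/matrixP=> x y; rewrite mul_principal_mxE !mxE rmorphMn /=.
have -> : (pt (rep x *m g) == pt (rep y *m g)) = (x == y).
  by apply/eqP/eqP=> [/(pt_mulmx_inj g0) | ->].
case: eqP => [-> | _]; last by rewrite mulr0.
rewrite mulr1n /weight rmorphM mulrACA !sigma_chi ?mulr1 //.
by rewrite sc_neq0 ?mul_rV2_neq0 ?rep_neq0.
Qed.

Definition intertwiner : 'M[L]_n := \matrix_(x, y) chi (wedge (rep x) (rep y)).

(** The two weights supply [chi (\det g)] twice and the transformation rule of [wedge] supplies it
    once more, so that a cube appears. *)
Lemma principal_mx_intertwiner g :
  \det g != 0 ->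
  principal_mx g *m intertwiner *m (principal_mx g)^T = intertwiner.
Proof.
move=> g0; apply: trmx_inj; rewrite trmx_mul trmxK.
apply/matrixP=> x y; rewrite mul_principal_mxE mxE mul_principal_mxE !mxE /weight.
set u := rep y *m g; set v := rep x *m g.
have [u0 v0] : u != 0 /\ v != 0 by rewrite !mul_rV2_neq0 ?rep_neq0.
have := wedgeMr (rep y) (rep x) g; rewrite -/u -/v.
rewrite {1}(rep_pt u0) {1}(rep_pt v0) wedgeZl wedgeZr => /(congr1 chi).
rewrite !chiM => E.
transitivity (chi (\det g) ^+ 2 *
  (chi (sc u) * (chi (sc v) * chi (wedge (rep (pt u)) (rep (pt v)))))); first by ring.
by rewrite E mulrA -exprSr chiX3 ?mul1r.
Qed.

(** By unitarity the conjugate of [principal_mx g] is inverse to its transpose, so multiplying the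
    invariance of the form by it on the right removes the transpose. *)
Lemma intertwiner_comm g :
  \det g != 0 ->
  principal_mx g *m intertwiner = intertwiner *m map_mx sigma (principal_mx g).
Proof.
move=> g0; rewrite -[in RHS](principal_mx_intertwiner g0) -!mulmxA.
congr (_ *m _); rewrite -[LHS]mulmx1; congr (_ *m _).
apply: trmx_inj; rewrite trmx_mul trmxK trmx1.
by rewrite (mulmx1C (principal_mx_unitary g0)).
Qed.

Lemma intertwiner_sym : (forall a, chi (- a) = chi a) -> intertwiner^T = intertwiner.
Proof. by move=> chiN; apply/matrixP=> x y; rewrite !mxE wedgeC chiN. Qed.

Lemma intertwiner_diag x : intertwiner x x = 0.
Proof. by rewrite mxE wedgevv. Qed.

(** * Absolute irreducibility *)

Definition mx2 (u v : 'rV[F]_2) : 'M[F]_2 :=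
  \matrix_(i, j) (if i == 0 then u 0 j else v 0 j).

Lemma mul_mx2 w u v : w *m mx2 u v = w 0 0 *: u + w 0 1 *: v.
Proof. by apply/rowP=> j; rewrite mulrV2E !mxE. Qed.

Lemma det_mx2 u v : \det (mx2 u v) = wedge u v.
Proof. by rewrite det2E !mxE. Qed.

Definition infty : pline F := enum_rank None.
Definition affine (a : F) : pline F := enum_rank (Some a).

Lemma pline_ind (P : pline F -> Prop) :
  P infty -> (forall a, P (affine a)) -> forall x, P x.
Proof.
move=> Pi Pa x; rewrite -(enum_valK x).
by case: (enum_val x) => [a|]; [apply: Pa | apply: Pi].
Qed.

Lemma rep_infty : rep infty = vec2 1 0.
Proof. by rewrite /rep enum_rankK. Qed.

Lemma rep_affine a : rep (affine a) = vec2 a 1.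
Proof. by rewrite /rep enum_rankK. Qed.

Lemma affine_inj : injective affine.
Proof. by move=> a b /enum_rank_inj[]. Qed.

Lemma affine_neq_infty a : (affine a == infty) = false.
Proof. by apply/eqP=> /enum_rank_inj. Qed.

Lemma principal_mx_unipotent b x y :
  principal_mx (mx2 (vec2 1 0) (vec2 b 1)) x y =
  (y == if enum_val x is Some a then affine (a + b) else infty)%:R.
Proof.
have det1 : \det (mx2 (vec2 1 0) (vec2 b 1)) = 1.
  by rewrite det_mx2 /wedge !mxE /=; ring.
rewrite mxE /weight det1 chi1 mul1r mul_mx2.
elim/pline_ind: x => [|a]; rewrite enum_rankK.
  rewrite rep_infty vec2E0 vec2E1 scale1r scale0r addr0 -rep_infty.
  by rewrite sc_rep pt_rep chi1.
rewrite rep_affine (_ : _ + _ = rep (affine (a + b))) ?sc_rep ?pt_rep ?chi1 //.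
by rewrite rep_affine; apply: rV2P; rewrite !mxE /=; ring.
Qed.

Lemma mul_principal_mx_torus a (C : 'M[L]_n) x y : a != 0 ->
  (principal_mx (mx2 (vec2 a 0) (vec2 0 1)) *m C) x y =
  if enum_val x is Some c then chi a * C (affine (c * a)) y
  else chi a ^+ 2 * C infty y.
Proof.
move=> a0; rewrite mul_principal_mxE /weight mul_mx2 det_mx2 /wedge !mxE /=.
rewrite mulr1 mul0r subr0.
elim/pline_ind: x => [|c]; rewrite enum_rankK.
  rewrite rep_infty vec2E0 vec2E1 scale1r scale0r addr0.
  rewrite (_ : vec2 a 0 = a *: rep infty); last first.
    by rewrite rep_infty; apply: rV2P; rewrite !mxE /= ?mulr1 ?mulr0.
  by rewrite ptZ // scZ // pt_rep sc_rep mulr1.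
rewrite (_ : _ + _ = rep (affine (c * a))); last first.
  by rewrite !rep_affine; apply: rV2P; rewrite !mxE /=; ring.
by rewrite pt_rep sc_rep chi1 mulr1.
Qed.

(** Exactly one translation takes an affine point to another, and all [#|F|] of them, an odd number,
    fix infinity. Thus [E] is all ones on the affine block, 1 at infinity and 0 elsewhere. The
    diagonal matrix multiplies the affine rows of [E] by [chi a] and the row of infinity by its
    square, so the subtraction kills the affine block. *)
Lemma infty_unit_mx a :
    odd #|F| -> 2%N \in [pchar L] -> a != 0 ->
  let E := \sum_b principal_mx (mx2 (vec2 1 0) (vec2 b 1)) in
  principal_mx (mx2 (vec2 a 0) (vec2 0 1)) *m E - chi a *: E =
  (chi a ^+ 2 - chi a) *: delta_mx infty infty.
Proof.
move=> oddF char2 a0 E.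
have EE x y : E x y = ((x == infty) == (y == infty))%:R.
  rewrite /E summxE; under eq_bigr do rewrite principal_mx_unipotent.
  elim/pline_ind: x => [|c]; rewrite enum_rankK ?eqxx.
    rewrite sumr_const -[_ *+ _]mulr_natr.
    by rewrite (natr_odd_pchar2 char2 oddF) mulr1; case: (_ == _).
  rewrite affine_neq_infty; elim/pline_ind: y => [|d].
    by rewrite eqxx big1 // => b _; rewrite eq_sym affine_neq_infty.
  rewrite affine_neq_infty (bigD1 (d - c)) //= [c + _]addrC subrK eqxx.
  rewrite big1 ?addr0 // => b ne_b; case: eqP => // /affine_inj e.
  by rewrite e [c + b]addrC addrK eqxx in ne_b.
apply/matrixP=> x y; rewrite mxE mul_principal_mx_torus // !mxE.
elim/pline_ind: x => [|c]; rewrite enum_rankK !EE ?eqxx ?affine_neq_infty /=.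
  by case: (y == infty); rewrite /= ?mulr1 // !mulr0 subr0.
by rewrite subrr mulr0.
Qed.

Definition principal_repr_mx (g : {'GL_2[F]}) : 'M[L]_n :=
  principal_mx (GLval g).

Lemma principal_repr_mx1 : principal_repr_mx 1%g = 1%:M.
Proof. exact: (principal_mx_scalar (oner_neq0 F)). Qed.

Lemma principal_repr_mxP : mx_repr 'GL_2[F] principal_repr_mx.
Proof.
split=> [|g h _ _]; first exact: principal_repr_mx1.
exact: (principal_mxM _ (GL_det g)).
Qed.

Definition principal_repr := MxRepresentation principal_repr_mxP.

Lemma envelop_principal_mx g : \det g != 0 ->
  (principal_mx g \in enveloping_algebra_mx principal_repr)%MS.
Proof.
rewrite -unitfE => Ug; have {}Ug : (g : 'M_(2.-1.+1)) \is a GRing.unit by [].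
have := envelop_mx_id principal_repr (in_setT (FinRing.Unit Ug : {'GL_2[F]})).
by [].
Qed.

Lemma exists_mx_infty_to x : exists2 h, \det h != 0 & rep infty *m h = rep x.
Proof.
elim/pline_ind: x => [|a].
  by exists 1%:M; rewrite ?det1 ?oner_neq0 ?mulmx1.
exists (mx2 (vec2 a 1) (vec2 1 0)); last first.
  by rewrite rep_infty rep_affine mul_mx2 !mxE scale1r scale0r addr0.
by rewrite det_mx2 /wedge !mxE /= mulr0 mulr1 add0r oppr_eq0 oner_eq0.
Qed.

Lemma principal_abs_irr a :
    odd #|F| -> 2%N \in [pchar L] -> a != 0 -> chi a != 1 ->
  mx_absolutely_irreducible principal_repr.
Proof.
move=> oddF char2 a0 chia1; apply/andP; split; first by rewrite card_option.
set A := enveloping_algebra_mx _.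
have sumA (I : finType) (f : I -> 'M[L]_n) :
  (forall i, f i \in A)%MS -> (\sum_i f i \in A)%MS.
  by move=> fA; rewrite linear_sum; apply: summx_sub => i _; apply: fA.
have scaleA c B : (B \in A)%MS -> (c *: B \in A)%MS.
  by move=> BA; rewrite linearZ scalemx_sub.
have torusA : (principal_mx (mx2 (vec2 a 0) (vec2 0 1)) \in A)%MS.
  by rewrite envelop_principal_mx // det_mx2 /wedge !mxE /= mulr1 mul0r subr0.
have unipA b : (principal_mx (mx2 (vec2 1 0) (vec2 b 1)) \in A)%MS.
  by rewrite envelop_principal_mx // det_mx2 /wedge !mxE /= mulr1 mul0r subr0 oner_neq0.
have chia0 : chi a ^+ 2 - chi a != 0.
  rewrite expr2 -{3}[chi a]mulr1 -mulrBr mulf_neq0 ?subr_eq0 //.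
  apply/eqP=> e; move/eqP: (sigma_chi a0).
  by rewrite e mul0r eq_sym oner_eq0.
have inftyA : (delta_mx infty infty \in A)%MS.
  have := infty_unit_mx oddF char2 a0; set E := \sum_b _ => /= defE.
  have EA : (E \in A)%MS by apply: sumA.
  rewrite -[delta_mx _ _](scalerK chia0) scaleA // -defE linearB addmx_sub //.
    exact: envelop_mxM.
  by rewrite eqmx_opp scaleA.
have deltaA x y : (delta_mx x y \in A)%MS.
  (* Multiplying the matrix unit at infinity by monomial matrices on both sides moves its row to [x]
     and its column to [y], up to a nonzero weight. *)
  have [h h0 hx] := exists_mx_infty_to x; have [k k0 ky] := exists_mx_infty_to y.
  have Uh : h \in unitmx by rewrite unitmxE unitfE.
  have h'0 : \det (invmx h) != 0 by rewrite det_inv invr_neq0.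
  have wx := weight_neq0 x h'0; have wy := weight_neq0 infty k0.
  suff -> : delta_mx x y = (weight (invmx h) x * weight k infty)^-1 *:
      (principal_mx (invmx h) *m (delta_mx infty infty *m principal_mx k)).
    by rewrite scaleA // !envelop_mxM ?envelop_principal_mx.
  apply: (canRL (scalerK _)); first by rewrite mulf_neq0.
  apply/matrixP=> i j; rewrite mul_principal_mxE !mxE.
  rewrite (bigD1 infty) //= big1 => [|z /negPf ne_z]; last first.
    by rewrite mxE ne_z andbF mul0r.
  rewrite !mxE eqxx andbT addr0 ky pt_rep.
  have -> : (pt (rep i *m invmx h) == infty) = (i == x).
    have -> : infty = pt (rep x *m invmx h) by rewrite -hx mulmxK // pt_rep.
    by apply/eqP/eqP=> [/(pt_mulmx_inj h'0) | ->].
  case: (i =P x) => [-> | _]; last by rewrite mul0r !mulr0.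
  by case: (j == y); rewrite ?mulr1 ?mul1r ?mulr0.
rewrite -sub1mx; apply/row_subP=> i; rewrite -[row i _]vec_mxK.
rewrite [vec_mx _]matrix_sum_delta.
by apply: (sumA) => x; apply: sumA => y; apply: scaleA.
Qed.

(** * The intertwiner composed with its conjugate *)

Lemma chiN a : chi (- a) = chi a.
Proof.
(* Both the square and the cube of [chi (-1)] are 1. *)
suff chiN1 : chi (-1) = 1 by rewrite -mulN1r chiM chiN1 mul1r.
have := chiX3 (_ : -1 != 0); rewrite oppr_eq0 oner_neq0 => /(_ isT).
by rewrite exprS expr2 -chiM mulrNN mulr1 chi1 mulr1.
Qed.

Lemma intertwiner_conj :
    odd #|F| -> 2%N \in [pchar L] -> (forall z, sigma (sigma z) = z) ->
    mx_absolutely_irreducible principal_repr ->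
  intertwiner *m map_mx sigma intertwiner = 1%:M.
Proof.
move=> oddF char2 sigmaK abs_irr; set K := intertwiner.
have sigma_mxK m p (B : 'M_(m, p)) : map_mx sigma (map_mx sigma B) = B.
  by apply/matrixP=> i j; rewrite !mxE sigmaK.
(* [K] leads from the representation to its conjugate and the conjugate of [K] leads back, so the
   product commutes with the representation. *)
have /(mx_abs_irr_cent_scalar abs_irr) : centgmx principal_repr (K *m map_mx sigma K).
  apply/centgmxP=> g _; set R := principal_repr g.
  have RK : R *m K = K *m map_mx sigma R by exact: (intertwiner_comm (GL_det g)).
  rewrite mulmxA RK -!mulmxA; congr (_ *m _).
  by rewrite -map_mxM RK map_mxM sigma_mxK.
case/is_scalar_mxP=> c defc; rewrite defc; congr _%:M.
(* The scalar is read at (infinity, infinity): the diagonal term vanishes and each of the other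
   [#|F|] points contributes 1. *)
have := congr1 (fun B : 'M_n => B infty infty) defc.
rewrite /K /= [RHS]mxE eqxx mulr1n => <-.
rewrite mxE (bigD1 infty) //= intertwiner_diag mul0r add0r.
rewrite (eq_bigr (fun=> 1)) => [|y ne_y]; last first.
  rewrite !mxE [wedge (rep y) _]wedgeC chiN sigma_chi //.
  by rewrite wedge_eq0 ?rep_neq0 // !pt_rep eq_sym.
rewrite sumr_const cardC1 card_ord card_option /=.
exact: natr_odd_pchar2.
Qed.

(** * Unisingularity and the action of the centre *)

Lemma mx2_row g : g = mx2 (row 0 g) (row 1 g).
Proof.
apply/matrixP=> i j; rewrite !mxE; case: i => [[|[|//]] lt_i] /=.
  by congr (g _ _); apply: val_inj.
by congr (g _ _); apply: val_inj.
Qed.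

Lemma scalar_mx2 g :
  g 0 1 = 0 -> g 1 0 = 0 -> g 0 0 = g 1 1 -> g = (g 0 0)%:M.
Proof.
move=> g01 g10 g00; rewrite [LHS]mx2_row [RHS]mx2_row.
by congr mx2; apply: rV2P; rewrite !mxE /= ?mulr1n ?mulr0n.
Qed.

(** If (1, 0), (0, 1) and (1, 1) are all eigenvectors, the first two make the matrix diagonal and
    the third makes its diagonal entries equal. A point with nonzero [wedge] is a cyclic vector. *)
Lemma exists_noneigenvector g :
  ~~ is_scalar_mx g -> exists x, wedge (rep x) (rep x *m g) != 0.
Proof.
move=> nscal; apply/existsP; apply: contraR nscal; rewrite negb_exists.
move=> /forallP noneig; have w0 x : wedge (rep x) (rep x *m g) = 0.
  by apply/eqP; have := noneig x; rewrite negbK.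
have := w0 (affine 1); have := w0 (affine 0); have := w0 infty.
rewrite rep_infty !rep_affine /wedge !mulrV2E !mxE /=.
rewrite !mul0r !mul1r !addr0 !add0r subr0 => g01 /eqP.
rewrite oppr_eq0 => /eqP g10; rewrite g01 g10 addr0 add0r => /eqP.
rewrite subr_eq0 => /eqP g11; apply/is_scalar_mxP; exists (g 0 0).
exact: scalar_mx2.
Qed.

(* A matrix commuting with [g] and fixing the line of a cyclic vector [v] of [g]
   acts by the same scalar on [v] and on [v g]. *)
Lemma scalar_of_comm_fixed g h x :
    g *m h = h *m g -> \det h != 0 -> wedge (rep x) (rep x *m g) != 0 ->
  pt (rep x *m h) = x -> is_scalar_mx h.
Proof.
move=> cgh h0; set v := rep x => w0 ptx.
have vh : v *m h = sc (v *m h) *: v.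
  by rewrite {1}(rep_pt (mul_rV2_neq0 h0 (rep_neq0 x))) ptx.
set c := sc _ in vh; apply/is_scalar_mxP; exists c.
have UB : mx2 v (v *m g) \in unitmx by rewrite unitmxE det_mx2 unitfE.
apply: (can_inj (mulKmx UB)); rewrite mul_mx_scalar [LHS]mx2_row [RHS]mx2_row.
have rowE (k : 'M[F]_2) i : row i (mx2 v (v *m g) *m k) =
    (if i == 0 then v else v *m g) *m k.
  by rewrite row_mul; congr (_ *m _); apply/rowP=> j; rewrite 2!mxE; case: (i == 0).
have scaleE i : row i (c *: mx2 v (v *m g)) = c *: (if i == 0 then v else v *m g).
  by apply/rowP=> j; do 2!rewrite [LHS]mxE; rewrite [RHS]mxE mxE; case: (i == 0).
by rewrite !rowE !scaleE /= -mulmxA cgh mulmxA !vh -scalemxAl.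
Qed.

Lemma principal_repr_scalar (g : {'GL_2[F]}) :
  is_scalar_mx (GLval g) -> principal_repr g = 1%:M.
Proof.
case/is_scalar_mxP=> c defg; have : \det (GLval g) != 0 by exact: (GL_det g).
rewrite defg det_scalar expf_eq0 /= => c0.
by rewrite /= /principal_repr_mx defg; apply: principal_mx_scalar.
Qed.

Lemma principal_unisingular (g : {'GL_2[F]}) :
  \det (principal_repr g - 1%:M) = 0.
Proof.
(* The minimal such [m] is the order of the image of [g] modulo scalars. *)
have exm : exists m, (0 < m)%N && is_scalar_mx (GLval (g ^+ m)%g).
  exists #[g]%g; rewrite order_gt0 expg_order /=.
  by apply/is_scalar_mxP; exists 1.
case: (ex_minnP exm) => m /andP[m_gt0 scal_m] min_m {exm}.
pose C := \sum_(i < m) principal_repr (g ^+ i)%g.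
have C_fix : principal_repr g *m C = C.
  (* Multiplication by [g] shifts the exponents by one; the new last term, at exponent [m], is
     scalar and acts as the term at exponent 0. *)
  rewrite mulmx_sumr (eq_bigr (fun i : 'I_m => principal_repr (g ^+ i.+1)%g)).
    case: m m_gt0 scal_m {min_m} @C => // m _ scal_m C.
    rewrite /C big_ord_recr [RHS]big_ord_recl /= addrC; congr (_ + _).
    by rewrite [LHS]principal_repr_scalar // expg0 principal_repr_mx1.
  by move=> i _; rewrite expgS repr_mxM ?inE.
have C_neq0 : C != 0.
  have [x x_ok] : exists x, forall i, (0 < i < m)%N ->
      pt (rep x *m GLval (g ^+ i)%g) != x.
    (* When [g] is scalar, minimality gives [m] = 1 and no exponent [i] remains; otherwise the line
       of a cyclic vector works. *)
    have [scal_g | /exists_noneigenvector[x wx]] := boolP (is_scalar_mx (GLval g)).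
      exists infty => i /andP[i_gt0 lt_im]; have := min_m 1%N; rewrite expg1 scal_g.
      by move/(_ isT); rewrite leqNgt (leq_ltn_trans i_gt0 lt_im).
    exists x => i /andP[i_gt0 lt_im]; apply/eqP=> fix_x.
    have := min_m i; rewrite i_gt0 (scalar_of_comm_fixed _ _ wx fix_x).
    - by move/(_ isT); rewrite leqNgt lt_im.
    - by have /(congr1 GLval) : (g * g ^+ i = g ^+ i * g)%g by rewrite -expgS expgSr.
    - exact: (GL_det (g ^+ i)%g).
  (* The diagonal entry of [C] at [x] is 1, since only the exponent 0 fixes [x]. *)
  apply/eqP=> /matrixP/(_ x x)/eqP; rewrite [in X in _ == X]mxE.
  rewrite summxE (bigD1 (Ordinal m_gt0)) //= big1 => [|i ne_i]; last first.
    rewrite mxE eq_sym (negPf (x_ok _ _)) // ltn_ord andbT lt0n.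
    by apply: contraNneq ne_i => i0; apply/eqP/val_inj.
  by rewrite expg0 addr0 principal_repr_mx1 mxE eqxx oner_eq0.
apply/eqP; apply: contraNT C_neq0; rewrite -unitfE => U.
apply/eqP/(can_inj (mulKmx (U : _ \in unitmx))).
by rewrite mulmx0 mulmxBl mul1mx C_fix subrr.
Qed.

(** Commuting with one upper and one lower elementary matrix already forces a matrix to be scalar,
    and scalars act trivially. *)
Lemma center_sub_rker_principal : 'Z('GL_2[F])%g \subset rker principal_repr.
Proof.
apply/subsetP=> z /centerP[_ cz]; apply/rkerP; split; first by rewrite inE.
have comm k : \det k != 0 -> GLval z *m k = k *m GLval z.
  rewrite -unitfE => Uk; have {}Uk : (k : 'M_(2.-1.+1)) \is a GRing.unit by [].
  by have /(congr1 GLval) := cz (FinRing.Unit Uk : {'GL_2[F]}) (in_setT _).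
apply: principal_repr_scalar; apply/is_scalar_mxP; exists (GLval z 0 0).
have cu : GLval z *m mx2 (vec2 1 1) (vec2 0 1) = mx2 (vec2 1 1) (vec2 0 1) *m GLval z.
  by apply: comm; rewrite det_mx2 /wedge !mxE /= mulr1 mulr0 subr0 oner_neq0.
have cl : GLval z *m mx2 (vec2 1 0) (vec2 1 1) = mx2 (vec2 1 0) (vec2 1 1) *m GLval z.
  by apply: comm; rewrite det_mx2 /wedge !mxE /= mulr1 mul0r subr0 oner_neq0.
have mulE (h k : 'M[F]_2) i j : (h *m k) i j = h i 0 * k 0 j + h i 1 * k 1 j.
  by have := mulrV2E (row i h) k j; rewrite -row_mul !mxE.
have /matrixP/(_ 0 0) := cl; have /matrixP/(_ 0 0) := cu.
have /matrixP/(_ 0 1) := cu; rewrite !mulE !mxE /= !mulr1 !mul1r !mulr0 !mul0r !addr0.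
move=> e1 e2 e3; apply: scalar_mx2.
- by apply: (addrI (GLval z 0 0)); rewrite addr0.
- by apply: (addrI (GLval z 0 0)); rewrite addr0.
- by move: e1; rewrite addrC => /addrI.
Qed.

End PrincipalSeries.

(** * Galois descent of a representation and its form to the field of two elements *)

Section Descent.

Local Open Scope ring_scope.

Variables (L : fieldType) (sigma : {rmorphism L -> L}) (iota : {rmorphism 'F_2 -> L}).
Hypothesis sigmaK : involutive sigma.
Hypothesis sigma_fix : forall z, sigma z = z -> z = 0 \/ z = 1.

Local Notation "A ^s" := (map_mx sigma A) (at level 8, format "A ^s").

Lemma sigma_mxK m n (A : 'M[L]_(m, n)) : A^s^s = A.
Proof. by apply/matrixP=> i j; rewrite !mxE sigmaK. Qed.

(* Hilbert 90 for GL_n: the rows r with r = r^s K^s span, as they include those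
   of 1 + K^s and of w + w^s K^s. *)
Lemma hilbert90_mx n (K : 'M[L]_n) w :
    sigma w != w -> K *m K^s = 1%:M ->
  exists2 P : 'M[L]_n, P \in unitmx & P = P^s *m K^s.
Proof.
move=> ww KK; pose d := sigma w - w.
have d0 : d != 0 by rewrite subr_eq0.
pose A := col_mx (1%:M + K^s) (w%:M + sigma w *: K^s).
have AA : A = A^s *m K^s.
  rewrite map_col_mx !map_mxD map_mxZ map_mx1 map_scalar_mx sigma_mxK sigmaK.
  rewrite mul_col_mx !mulmxDl mul1mx mul_scalar_mx -scalemxAl KK scalemx1.
  by rewrite addrC [_ *: _ + _]addrC.
have fullA : row_full A.
  (* [sigma w] times the first block of [A] minus the second is [d] times the identity. *)
  apply/row_fullP; exists (row_mx (sigma w / d)%:M (- d^-1)%:M).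
  rewrite mul_row_col !mul_scalar_mx !scalerDr -[w%:M]scalemx1 !scalerA.
  rewrite addrACA -!scalerDl -[RHS]scale1r -[RHS]addr0; congr (_ + _).
    by congr (_ *: _); rewrite mulNr mulrC -mulrBr mulVf.
  by rewrite mulNr [_ / d]mulrC subrr scale0r.
exists (rowsub (fullrankfun fullA) A).
  by rewrite -row_full_unit; apply: fullrowsub_full.
by move: (fullrankfun fullA) => f; rewrite {1}AA map_mxsub mul_rowsub_mx.
Qed.

(** Inverse to [iota] on 0 and 1, the only elements that [sigma] can fix; every other element goes
    to 1. *)
Definition toF2 (z : L) : 'F_2 := (z != 0)%:R.

Lemma toF2K m n (A : 'M[L]_(m, n)) : A^s = A -> map_mx iota (map_mx toF2 A) = A.
Proof.
move=> fixA; apply/matrixP=> i j; rewrite !mxE /toF2 rmorph_nat.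
have : sigma (A i j) = A i j by move/matrixP/(_ i j): fixA; rewrite mxE.
by case/sigma_fix=> ->; rewrite ?eqxx ?oner_neq0.
Qed.

Lemma alternating_of_sym_diag0 n (K : 'M[L]_n) :
    2%N \in [pchar L] -> K^T = K -> (forall i, K i i = 0) -> alternating_form K.
Proof.
move=> char2 symK diagK v.
(* With [B] the strictly upper triangular part, the values of [K] and [B] on (v, v) differ by a
   factor 2, which is 0. *)
pose B : 'M[L]_n := \matrix_(i, j) (K i j *+ (i < j)%N).
have -> : K = B + B^T.
  apply/matrixP=> i j; rewrite !mxE; have := congr1 (fun M : 'M_n => M i j) symK.
  rewrite !mxE => ->; case: ltngtP => [||/val_inj ->]; rewrite ?addr0 ?add0r //.
rewrite mulmxDr mulmxDl.
have -> : v *m B^T *m v^T = (v *m B *m v^T)^T by rewrite !trmx_mul trmxK mulmxA.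
apply/matrixP=> i j; rewrite !ord1 !mxE -mulr2n -mulr_natr (pcharf0 char2).
exact: mulr0.
Qed.

Variables (gT : finGroupType) (G : {group gT}) (n : nat).
Variables (rG : mx_representation L G n) (K : 'M[L]_n) (w : L).

(** In the basis [P] from Hilbert 90, conjugation by [sigma] turns [P] into [P *m K]. Since [K]
    intertwines [rG] with its conjugate, the matrices of [rG] in that basis are fixed by [sigma], so
    their entries lie in the prime field. *)
Lemma symplectic_descent :
    sigma w != w -> 2%N \in [pchar L] -> K^T = K -> (forall i, K i i = 0) ->
    K *m K^s = 1%:M ->
    (forall g, g \in G -> rG g *m K = K *m (rG g)^s) ->
    (forall g, g \in G -> rG g *m K *m (rG g)^T = K) ->
  exists (J : 'M['F_2]_n) (rG2 : mx_representation 'F_2 G n) (P : 'M[L]_n),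
    [/\ alternating_form J, nondegenerate_form J,
        forall g, g \in G -> rG2 g \in Sp J, P \in unitmx &
        forall g, g \in G -> map_mx iota (rG2 g) *m P = P *m rG g].
Proof.
move=> ww char2 symK diagK KK RK RKR.
have [P UP defP] := hilbert90_mx ww KK.
have defPs : P^s = P *m K.
  by rewrite {1}defP map_mxM !sigma_mxK.
pose S g := P *m rG g *m invmx P.
have SP g : S g *m P = P *m rG g by rewrite mulmxKV.
have S_fix g : g \in G -> (S g)^s = S g.
  move=> Gg; apply: (can_inj (mulmxK UP)); rewrite SP.
  have UK : K \in unitmx by case/mulmx1_unit: KK.
  apply: (can_inj (mulmxK UK)); rewrite -[LHS]mulmxA -defPs -map_mxM SP.
  by rewrite map_mxM defPs -!mulmxA RK.
pose r g := map_mx toF2 (S g).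
have rP g : g \in G -> map_mx iota (r g) = S g by move=> Gg; rewrite toF2K ?S_fix.
have r_repr : mx_repr G r.
  split=> [|g h Gg Gh]; apply: (map_mx_inj (f := iota)).
    by rewrite map_mx1 rP // /S repr_mx1 mulmx1 mulmxV.
  by rewrite map_mxM !rP ?groupM // /S repr_mxM // !mulmxA mulmxKV.
pose J0 := P *m K *m P^T.
have J0_fix : J0^s = J0.
  have J0E : J0 = P^s *m P^T by rewrite defPs.
  (* Conjugating [P^s *m P^T] gives its transpose, so the symmetry of [J0] makes it fixed by
     [sigma]. *)
  have : J0^T = J0 by rewrite /J0 !trmx_mul trmxK symK mulmxA.
  by move=> {1}<-; rewrite J0E trmx_mul trmxK map_mxM -map_trmx sigma_mxK.
pose J := map_mx toF2 J0.
have JE : map_mx iota J = J0 by rewrite toF2K.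
exists J, (MxRepresentation r_repr), P; split=> //.
- move=> u; apply: (map_mx_inj (f := iota)); rewrite !map_mxM JE map_mx0 -map_trmx.
  have := alternating_of_sym_diag0 char2 symK diagK (map_mx iota u *m P).
  by rewrite trmx_mul /J0 !mulmxA.
- have UJ : J \in unitmx.
    rewrite -(map_unitmx iota) JE !unitmx_mul unitmx_tr UP andbT /=.
    by case/mulmx1_unit: KK.
  move=> u u0; apply: (can_inj (mulmxK UJ)); rewrite mul0mx; apply/rowP=> j.
  have := congr1 (fun M : 'M_1 => M 0 0) (u0 (delta_mx 0 j)).
  by rewrite trmx_delta -colE !mxE.
- move=> g Gg; apply/eqP/(map_mx_inj (f := iota)); rewrite !map_mxM JE -map_trmx rP //.
  rewrite /J0 !mulmxA SP.
  by rewrite -[LHS]mulmxA -trmx_mul SP trmx_mul mulmxA -!(mulmxA P) RKR.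
- by move=> g Gg; rewrite /= rP ?SP.
Qed.

End Descent.

(** * Cubic characters of a finite field *)

Section CubicCharacter.

Local Open Scope ring_scope.

(** A generator [z] of the multiplicative group is sent to [w]. Exponents of [z] are determined
    modulo [#|F|.-1], hence modulo 3, which suffices for powers of [w]. *)
Lemma exists_cubic_character (F : finFieldType) (L : fieldType) (w : L) :
    w ^+ 3 = 1 -> (3 %| #|F|.-1)%N ->
  exists chi : F -> L,
    [/\ chi 0 = 0, chi 1 = 1, {morph chi : x y / x * y},
        forall x, x != 0 -> chi x ^+ 3 = 1 & exists2 a, a != 0 & chi a = w].
Proof.
move=> w3 dvd3; set m := #|F|.-1 in dvd3.
have m_gt0 : (0 < m)%N by rewrite /m -subn1 subn_gt0 finNzRing_gt1.
have unityF (x : F) : x != 0 -> x ^+ m = 1.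
  move=> x0; apply: (mulfI x0); rewrite mulr1 -exprS prednK ?expf_card //.
  exact: ltnW (finNzRing_gt1 F).
have [z prim_z] : exists z : F, m.-primitive_root z.
  have /hasP[z _ prim_z] : has m.-primitive_root (enum [set~ (0 : F)]).
    apply: has_prim_root => //; last by rewrite -cardE cardsC1.
      apply/allP=> x; rewrite mem_enum !inE => x0.
      by apply/unity_rootP; apply: unityF.
    exact: enum_uniq.
  by exists z.
have z0 : z != 0.
  apply/eqP=> e; have := prim_expr_order prim_z; rewrite e expr0n eqn0Ngt m_gt0.
  by move/eqP; rewrite eq_sym oner_eq0.
(* No power of [z] is 0, so the default branch is what gives [chi 0 = 0]. *)
pose chi (x : F) := if [pick i : 'I_m | x == z ^+ i] is Some i then w ^+ i else 0.
have chiX k : chi (z ^+ k) = w ^+ k.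
  rewrite /chi; case: pickP => [i | /(_ (Ordinal (ltn_pmod k m_gt0)))]; last first.
    by rewrite /= prim_expr_mod // eqxx.
  rewrite (eq_prim_root_expr prim_z) => /eqP/(congr1 (modn^~ 3)).
  by rewrite !modn_dvdm // => e; rewrite -(expr_mod k w3) e; rewrite expr_mod.
have logP x : x != 0 -> exists k, x = z ^+ k.
  by move=> /unityF/(prim_rootP prim_z)[i ->]; exists i.
have chi0 : chi 0 = 0.
  rewrite /chi; case: pickP => // i; rewrite eq_sym expf_eq0.
  by rewrite (negPf z0) andbF.
exists chi; split=> //.
- by rewrite -(expr0 z) chiX.
- move=> x y; have [-> | /logP[i ->]] := eqVneq x 0; first by rewrite mul0r chi0 mul0r.
  have [-> | /logP[j ->]] := eqVneq y 0; first by rewrite mulr0 chi0 mulr0.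
  by rewrite -exprD !chiX exprD.
- by move=> x /logP[k ->]; rewrite chiX -exprM mulnC exprM w3 expr1n.
- by exists z => //; rewrite -[z in chi z]expr1 chiX.
Qed.

End CubicCharacter.

(** * The field of order four with its Frobenius involution *)

Section FieldOfOrderFour.

Local Open Scope ring_scope.

(** With [sigma] the squaring map, its fixed points solve z^2 = z, the product of z and [sigma z] is
    z^3, and [sigma] is an involution because z^4 = z. Any [w] other than 0 and 1 is then a
    primitive cube root of unity. *)
Lemma exists_F4 : exists (L : fieldType) (sigma : {rmorphism L -> L})
    (iota : {rmorphism 'F_2 -> L}) (w : L),
  [/\ 2%N \in [pchar L], involutive sigma,
      forall z, sigma z = z -> z = 0 \/ z = 1,
      forall z, z ^+ 3 = 1 -> z * sigma z = 1 &
      [/\ w ^+ 3 = 1, w != 1 & sigma w != w]].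
Proof.
have [L char2 cardL] := pPrimePowerField (isT : prime 2) (isT : 0 < 2)%N.
have card4 (z : L) : z ^+ 4 = z by rewrite -[in RHS](expf_card z) cardL.
have sqr_fix (z : L) : z ^+ 2 = z -> z = 0 \/ z = 1.
  move/eqP; rewrite expr2 -subr_eq0 -{3}[z]mulr1 -mulrBr mulf_eq0 subr_eq0.
  by case/orP=> /eqP; [left | right].
have [w] : exists w : L, w \notin [set 0; 1].
  apply/existsP; rewrite -negb_forall; apply/forallP=> all01.
  have := cardL; rewrite -cardsT.
  have -> : setT = [set 0; 1 : L] by apply/setP=> z; rewrite all01 inE.
  by rewrite cards2; case: (_ == _).
rewrite !inE negb_or => /andP[w0 w1].
pose iota : {rmorphism 'F_2 -> pPrimeCharType char2} := in_alg (pPrimeCharType char2).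
exists L, (pFrobenius_aut char2), iota, w.
split=> //.
  by move=> z /=; rewrite !pFrobenius_autE -exprM card4.
rewrite /= pFrobenius_autE; split=> //.
  by apply: (mulfI w0); rewrite -exprS card4 mulr1.
by apply: contraNneq w1 => /sqr_fix[] e; rewrite e ?eqxx // -e eqxx in w0 *.
Qed.

End FieldOfOrderFour.

Theorem theorem1p7 (p k q : nat) (p_prime : prime p) (k_gt0 : 0 < k)
    (q_def : q = p ^ k) (q_mod4 : 4 %| q + 1) (q_mod3 : 3 %| q - 1)
    (F : finFieldType) (card_F : #|F| = q) :
  exists (J : 'M['F_2]_(q + 1)%N)
         (rG : mx_representation 'F_2 (PGL 2 F) (q + 1)%N),
    [/\ alternating_form J,
        nondegenerate_form J,
        forall g, g \in PGL 2 F -> rG g \in Sp J,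
        mx_absolutely_irreducible rG
      & unisingular rG].
Proof.
have oddF : odd #|F|.
  by have := dvdn_trans (isT : 2 %| 4) q_mod4; rewrite dvdn2 addn1 /= negbK card_F.
have dvd3 : 3 %| #|F|.-1 by rewrite card_F -subn1.
have -> : q + 1 = #|{: option F}| by rewrite card_option card_F addn1.
have [L [sigma [iota [w [char2 sigmaK sigma_fix sigma3 [w3 w1 ww]]]]]] := exists_F4.
have [chi [chi0 chi1 chiM chiX3 [a a0 chia]]] := exists_cubic_character w3 dvd3.
have sigma_chi x : x != 0%R -> (chi x * sigma (chi x))%R = 1%R.
  by move/chiX3/sigma3.
pose rL := principal_repr chiM chiX3.
have rL_irr : mx_absolutely_irreducible rL.
  by apply: (principal_abs_irr chi1 _ _ sigma_chi oddF char2 a0); rewrite chia.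
have [J [r [P [altJ nondegJ SpJ UP rP]]]] :=
  symplectic_descent (rG := rL) iota sigmaK sigma_fix ww char2
    (intertwiner_sym (chiN chi1 chiM chiX3)) (intertwiner_diag chi0)
    (intertwiner_conj chi0 chi1 sigma_chi oddF char2 sigmaK rL_irr)
    (fun g _ => intertwiner_comm chiM chiX3 sigma_chi (GL_det g))
    (fun g _ => principal_mx_intertwiner chiM chiX3 (GL_det g)).
have r_simE g : g \in 'GL_2[F]%g ->
    map_mx iota (r g) = (P *m rL g *m invmx P)%R.
  by move=> Gg; rewrite -rP // mulmxK.
(* A scalar matrix acts trivially over [L], hence also in the descended representation, by
   injectivity of [iota]; this yields a representation of the quotient by the centre. *)
have ker_r : 'Z('GL_2[F])%g \subset rker r.
  apply: subset_trans (center_sub_rker_principal chiM chiX3) _.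
  apply/subsetP=> z /rkerP[Gz rz]; apply/rkerP; split=> //.
  apply: (map_mx_inj (f := iota)); rewrite r_simE // [rL z]rz mulmx1 mulmxV //.
  by rewrite map_mx1.
have nZ : 'GL_2[F]%g \subset 'N('Z('GL_2[F]))%g by rewrite normal_norm ?center_normal.
exists J, (quo_repr ker_r nZ); split=> //.
- by move=> _ /morphimP[g _ Gg ->]; rewrite quo_repr_coset // SpJ.
(* Absolute irreducibility is insensitive to extension of scalars and to similarity, so it passes
   from [rL] to [r]; the quotient representation has the same enveloping algebra as [r]. *)
- have [n_gt0 full_r] : 0 < #|{: option F}| /\ row_full (enveloping_algebra_mx r).
    apply/andP; rewrite -/(mx_absolutely_irreducible r) -(map_mx_abs_irr iota).
    rewrite (mx_rsim_abs_irr (rG2 := rL)) //.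
    by exists P => //; rewrite row_free_unit.
  by rewrite /mx_absolutely_irreducible n_gt0 /row_full quo_mx_quotient.
(* The determinant may be computed over [L], where conjugation by [P] reduces it to the one for
   [rL]. *)
- move=> _ /morphimP[g _ Gg ->]; rewrite quo_repr_coset //.
  apply: (fmorph_inj iota); rewrite rmorph0 -det_map_mx map_mxB map_mx1 r_simE //.
  have -> : (P *m rL g *m invmx P - 1%:M = P *m (rL g - 1%:M) *m invmx P)%R.
    by rewrite mulmxBr mulmx1 mulmxBl mulmxV.
  have det0 : (\det (rL g - 1%:M) = 0)%R by apply: principal_unisingular.
  by rewrite !det_mulmx det0 mulr0 mul0r.
Qed.
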